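(* Consider the 1v1 reach-avoid differential game between an evader $E_i$ and a pursuer $P_j$ with speed ratio $\alpha_{ij}=U_i/V_j\le 1$, for states $\mathbf{x}=(\mathbf{x}_{E_i},\mathbf{x}_{P_j})\in\mathsf{R}_E$ (the evader winning region) that are not terminal. The Value function of the game is $C^1$, it is the solution of the Hamilton-Jacobi-Isaacs equation $$\min_{\|\mathbf{u}_i\|=U_i}\ \max_{\|\mathbf{v}_j\|=V_j}\Big[\Big\langle \tfrac{\partial \mathcal{V}}{\partial \mathbf{x}_{E_i}},\mathbf{u}_i\Big\rangle+\Big\langle \tfrac{\partial \mathcal{V}}{\partial \mathbf{x}_{P_j}},\mathbf{v}_j\Big\rangle\Big]=0,$$ and it is given by $$\mathcal{V}_{ij}^E(\mathbf{x})=-R_{P_j}+\frac{R_{E_i}}{\alpha_{ij}},\qquad R_{P_j}=\|\mathbf{x}_{P_j}\|,\quad R_{E_i}=\|\mathbf{x}_{E_i}\|.$$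
   Context: 1v1 reach-avoid differential game: the evader $E_i$ at $\mathbf{x}_{E_i}\in\mathbb{R}^3$ and the pursuer $P_j$ at $\mathbf{x}_{P_j}\in\mathbb{R}^3$ move according to $\dot{\mathbf{x}}_{E_i}=\mathbf{u}_i$, $\dot{\mathbf{x}}_{P_j}=\mathbf{v}_j$, with controls satisfying $\|\mathbf{u}_i\|=U_i>0$, $\|\mathbf{v}_j\|=V_j>0$. The target is the origin. The game terminates when either the evader reaches the target ($\mathbf{x}_{E_i}=0$) or the evader is captured away from the target ($\mathbf{x}_{P_j}=\mathbf{x}_{E_i}\neq 0$); states satisfying one of these conditions are terminal. Evader winning region: $\mathsf{R}_E=\{\mathbf{x}\in\mathbb{R}^6:\|\mathbf{x}_{E_i}\|^2-\alpha_{ij}^2\|\mathbf{x}_{P_j}\|^2\le 0\}$; it is the set of initial states from which the evader can guarantee reaching the target (simultaneous arrival of both players at the target counts as an evader win). Payoff in $\mathsf{R}_E$: $J(\mathbf{u}_i(\cdot),\mathbf{v}_j(\cdot);\mathbf{x}_0)=-\|\mathbf{x}_{P_{j_f}}\|$, the negative of the distance of the terminal position $\mathbf{x}_{P_{j_f}}$ of the pursuer from the target. The evader minimizes and the pursuer maximizes. The Value function is $\mathcal{V}(\mathbf{x}_0)=\min_{\mathbf{u}_i(\cdot)}\max_{\mathbf{v}_j(\cdot)}J(\mathbf{u}_i(\cdot),\mathbf{v}_j(\cdot);\mathbf{x}_0)$ subject to the dynamics and termination rule, over state feedback strategies. *)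

(* Defs.v *)
(* MathComp / MathComp-Analysis development over an abstract R : realType. *)
From HB Require Import structures.
From mathcomp Require Import all_boot all_order all_algebra.
From mathcomp Require Import all_classical all_reals all_analysis.

Set Implicit Arguments.
Unset Strict Implicit.
Unset Printing Implicit Defensive.

Import Order.TTheory GRing.Theory Num.Theory.
Import numFieldNormedType.Exports.

Local Open Scope classical_set_scope.
Local Open Scope ring_scope.

(* The library norm on 'rV[R]_n is the max norm, hence the explicit Euclidean
   one.  The topology, differentiability and continuity below are those of the
   library's (equivalent) max norm. *)
Definition dot (R : realType) (x y : 'rV[R]_3) : R := \sum_(i < 3) x 0 i * y 0 i.

Definition enorm (R : realType) (x : 'rV[R]_3) : R := Num.sqrt (dot x x).

(* A state is the pair (x_E, x_P) of the evader's and the pursuer's positions. *)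
Definition state (R : realType) := ('rV[R]_3 * 'rV[R]_3)%type.

Definition terminal (R : realType) (x : state R) : Prop :=
  x.1 = 0 \/ (x.2 = x.1 /\ x.1 != 0).

Definition evader_region (R : realType) (alpha : R) : set (state R) :=
  [set x | enorm x.1 ^+ 2 - alpha ^+ 2 * enorm x.2 ^+ 2 <= 0].

(** Controls and trajectories *)

Definition control (R : realType) (s : R) (c : R -> 'rV[R]_3) : Prop :=
  (forall i, measurable_fun (`[0, +oo[ : set R) (fun t : R => c t 0 i)) /\
  (forall t, 0 <= t -> enorm (c t) = s).

(* Caratheodory solution of x' = c(t), written as an integral equation. *)
Definition displacement (R : realType) (c : R -> 'rV[R]_3) (t : R) : 'rV[R]_3 :=
  \row_i \int[lebesgue_measure]_(s in `[0, t]) c s 0 i.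

Definition traj (R : realType) (x0 : state R) (u v : R -> 'rV[R]_3) (t : R)
    : state R :=
  (x0.1 + displacement u t, x0.2 + displacement v t).

Definition running (R : realType) (z : R -> state R) (t : R) : Prop :=
  forall s, 0 <= s <= t -> ~ terminal (z s).

(* The control c is generated along z by the state feedback law k.  Only the
   motion before termination matters: afterwards controls are unconstrained, so
   that trajectories can be taken on the whole half-line. *)
Definition generated_by (R : realType) (k : state R -> 'rV[R]_3)
    (z : R -> state R) (c : R -> 'rV[R]_3) : Prop :=
  forall t, 0 <= t -> running z t -> c t = k (z t).

(** State feedback strategies *)

(* Feedback laws may be discontinuous; a law is a strategy when, from every
   initial state and against every open-loop control of the opponent, the closed
   loop has a solution up to termination. *)
Definition evader_strategy (R : realType) (U V : R) (g : state R -> 'rV[R]_3)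
    : Prop :=
  (forall x, enorm (g x) = U) /\
  (forall x0 v, control V v ->
     exists2 u, control U u & generated_by g (traj x0 u v) u).

Definition pursuer_strategy (R : realType) (U V : R) (h : state R -> 'rV[R]_3)
    : Prop :=
  (forall x, enorm (h x) = V) /\
  (forall x0 u, control U u ->
     exists2 v, control V v & generated_by h (traj x0 u v) v).

Definition play (R : realType) (U V : R) (g h : state R -> 'rV[R]_3)
    (x0 : state R) (z : R -> state R) : Prop :=
  exists u v, [/\ control U u, control V v, z = traj x0 u v,
    generated_by g z u & generated_by h z v].

(** Payoff and Value *)

(* T is the terminal time and the evader is then at the target (possibly
   together with the pursuer). *)
Definition reaches_target (R : realType) (z : R -> state R) (T : R) : Prop :=
  [/\ 0 <= T, (z T).1 = 0 & forall s, 0 <= s < T -> ~ terminal (z s)].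

(* There is at most one T with reaches_target z T.  If there is one the payoff
   is - |x_P(T)|; otherwise (capture away from the target, or no termination)
   the infimum is over the empty set and the payoff is +oo, a loss for the
   minimizing evader. *)
Definition payoff (R : realType) (z : R -> state R) : \bar R :=
  ereal_inf [set (- enorm (z T).2)%:E | T in reaches_target z].

(* Worst payoff under the evader strategy g; the supremum also runs over all
   solutions of the closed loop when these are not unique. *)
Definition guaranteed_payoff (R : realType) (U V : R) (g : state R -> 'rV[R]_3)
    (x0 : state R) : \bar R :=
  ereal_sup [set p | exists h z,
    [/\ pursuer_strategy U V h, play U V g h x0 z & p = payoff z]].

Definition game_value (R : realType) (U V : R) (x0 : state R) : \bar R :=
  ereal_inf [set guaranteed_payoff U V g x0 | g in evader_strategy U V].

(* The outer infimum is a minimum and, at a minimizing g, the inner supremum is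
   a maximum. *)
Definition value_attained (R : realType) (U V : R) (x0 : state R) : Prop :=
  exists2 g, evader_strategy U V g &
    guaranteed_payoff U V g x0 = game_value U V x0 /\
    exists h z, [/\ pursuer_strategy U V h, play U V g h x0 z &
      payoff z = game_value U V x0].

(** C^1 regularity and the Hamilton-Jacobi-Isaacs equation *)

(* (df/dx_E, df/dx_P), by partial derivatives. *)
Definition gradient (R : realType) (f : state R -> R) (x : state R) : state R :=
  (\row_i 'D_((delta_mx 0 i, 0) : state R) f x,
   \row_i 'D_((0, delta_mx 0 i) : state R) f x).

(* f is C^1 on the (not necessarily open) set S with gradient G there: f agrees
   on S with a C^1 function on an open neighbourhood of S. *)
Definition C1_with_gradient (R : realType) (S : set (state R))
    (f : state R -> R) (G : state R -> state R) : Prop :=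
  exists (O : set (state R)) (F : state R -> R),
    [/\ open O, S `<=` O,
        forall x, O x -> differentiable F x /\ {for x, continuous (gradient F)} &
        forall x, S x -> F x = f x /\ gradient F x = G x].

Definition is_max (R : realType) (A : set R) (m : R) : Prop := A m /\ ubound A m.
Definition is_min (R : realType) (A : set R) (m : R) : Prop := A m /\ lbound A m.

(* min over |u| = U of max over |v| = V of <p.1, u> + <p.2, v> is zero. *)
Definition isaacs_equation (R : realType) (U V : R) (p : state R) : Prop :=
  is_min [set m | exists2 u, enorm u = U &
    is_max [set dot p.1 u + dot p.2 v | v in [set v | enorm v = V]] m] 0.

(* Main.v *)
Require Import Defs.
From HB Require Import structures.
From mathcomp Require Import all_boot all_order all_algebra.
From mathcomp Require Import all_classical all_reals all_analysis.
From mathcomp Require Import measurable_realfun.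
From mathcomp Require Import ring lra.

Set Implicit Arguments.
Unset Strict Implicit.
Unset Printing Implicit Defensive.

Import Order.TTheory GRing.Theory Num.Theory.
Import numFieldNormedType.Exports.

Local Open Scope classical_set_scope.
Local Open Scope ring_scope.

(** Write [W = - |x_P| + |x_E| / alpha] for the state [x] from which the game is
    played; [|x_E| / U] is the least time in which the evader can arrive, and
    [- W] is the distance to the target of a pursuer that has run straight
    towards it during that time.

    Upper bound ([straight_run_payoff]).  The Value at [x] is an infimum over
    feedback laws for this one [x], so the law may depend on [x]; the constant
    law heading from [x_E] to the target is enough, and it determines the
    evader's motion up to termination.  The pursuer cannot intercept it
    ([straight_run_not_caught]), and has moved by at most [V |x_E| / U] when the
    evader arrives.

    Lower bound ([patrol_guaranteed]).  The pursuer has to answer an arbitrary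
    evader feedback, possibly discontinuous; two laws that both react to the
    opponent need not have a joint closed-loop solution.  The pursuer's law
    therefore depends on [x_P] only: its motion is then known in advance, and an
    evader strategy has by definition a response to it.  Running to the target
    and stopping there is impossible, since the speed is always [V], and running
    through it would reward an evader that waits.  So the pursuer stops its approach at a
    radius [r] slightly larger than [- W] and circles around the target.  The
    radius [r] is reached before the time [|x_E| / U], hence every arrival of the
    evader costs at least [- r].  This [patrol] law has a closed-loop solution
    from every initial position: straight until the first meeting with the
    circle, if there is one, and along the circle from then on.

    When both players run straight, the payoff is exactly [W], so the bounds are
    attained.  Away from [x_E = 0] and [x_P = 0], an open set that contains the
    states considered, [W] is smooth with gradient
    [(x_E / (alpha |x_E|), - x_P / |x_P|)], and the Isaacs equation becomes
    [- U / alpha + V = 0] by Cauchy-Schwarz. *)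

(** * Euclidean geometry of the space of positions *)

Section Euclidean.
Context {R : realType}.
Implicit Types (x y z : 'rV[R]_3) (a : R).

Lemma dotC x y : dot x y = dot y x.
Proof. by apply: eq_bigr => i _; rewrite mulrC. Qed.

Lemma dotDl x y z : dot (x + y) z = dot x z + dot y z.
Proof. by rewrite -big_split; apply: eq_bigr => i _; rewrite mxE mulrDl. Qed.

Lemma dotDr x y z : dot x (y + z) = dot x y + dot x z.
Proof. by rewrite dotC dotDl ![dot _ x]dotC. Qed.

Lemma dotZl a x y : dot (a *: x) y = a * dot x y.
Proof. by rewrite mulr_sumr; apply: eq_bigr => i _; rewrite mxE mulrA. Qed.

Lemma dotZr a x y : dot x (a *: y) = a * dot x y.
Proof. by rewrite dotC dotZl dotC. Qed.

Lemma dotNl x y : dot (- x) y = - dot x y.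
Proof. by rewrite -scaleN1r dotZl mulN1r. Qed.

Lemma dotNr x y : dot x (- y) = - dot x y.
Proof. by rewrite dotC dotNl dotC. Qed.

Definition dotE := (dotDl, dotDr, dotNl, dotNr, dotZl, dotZr).

Lemma dot_ge0 x : 0 <= dot x x.
Proof. by apply: sumr_ge0 => i _; rewrite -expr2 sqr_ge0. Qed.

Lemma dot_eq0 x : (dot x x == 0) = (x == 0).
Proof.
apply/eqP/eqP => [x0|->]; last by rewrite -(scale0r 0) dotZl mul0r.
apply/rowP => i; rewrite mxE; apply/eqP; rewrite -sqrf_eq0 expr2; apply/eqP.
by apply: (psumr_eq0P _ x0) => // j _; rewrite -expr2 sqr_ge0.
Qed.

Lemma enorm_ge0 x : 0 <= enorm x.
Proof. exact: sqrtr_ge0. Qed.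

Lemma sqr_enorm x : enorm x ^+ 2 = dot x x.
Proof. by rewrite sqr_sqrtr ?dot_ge0. Qed.

Lemma enorm_eq0 x : (enorm x == 0) = (x == 0).
Proof. by rewrite -dot_eq0 -sqr_enorm sqrf_eq0. Qed.

Lemma enorm_gt0 x : (0 < enorm x) = (x != 0).
Proof. by rewrite lt_def enorm_eq0 enorm_ge0 andbT. Qed.

Lemma enormZ a x : enorm (a *: x) = `|a| * enorm x.
Proof.
by rewrite /enorm dotZl dotZr mulrA -expr2 sqrtrM ?sqr_ge0// sqrtr_sqr.
Qed.

Lemma enormN x : enorm (- x) = enorm x.
Proof. by rewrite -scaleN1r enormZ normrN1 mul1r. Qed.

(** Cauchy-Schwarz: expand the squared norm of [(y.y) x - (x.y) y]. *)
Lemma dot_le_enorm x y : dot x y <= enorm x * enorm y.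
Proof.
have [->|y0] := eqVneq y 0.
  by rewrite -(scale0r 0) dotZr mul0r mulr_ge0 ?enorm_ge0.
have yy : 0 < dot y y by rewrite lt_def dot_eq0 y0 dot_ge0.
have := dot_ge0 (dot y y *: x - dot x y *: y).
rewrite !dotE (dotC y x) => h.
have {}h : 0 <= dot y y * (dot x x * dot y y - dot x y ^+ 2).
  by apply: le_trans h _; rewrite le_eqVlt; apply/orP; left; apply/eqP; ring.
rewrite pmulr_rge0// subr_ge0 -!sqr_enorm -exprMn in h.
rewrite (le_trans (ler_norm _))// -(ger0_norm (mulr_ge0 _ _)) ?enorm_ge0//.
by rewrite -ler_sqr ?nnegrE// !real_normK ?num_real.
Qed.

Lemma ler_enormD x y : enorm (x + y) <= enorm x + enorm y.
Proof.
rewrite -ler_sqr ?nnegrE ?addr_ge0 ?enorm_ge0// sqr_enorm !dotE (dotC y x).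
by rewrite sqrrD !sqr_enorm; have := dot_le_enorm x y; lra.
Qed.

Lemma ler_enormB x y : enorm x - enorm y <= enorm (x - y).
Proof. by rewrite lerBlDr (le_trans _ (ler_enormD _ _))// subrK. Qed.

Definition direction x := (enorm x)^-1 *: x.

Lemma enorm_direction x : x != 0 -> enorm (direction x) = 1.
Proof.
move=> x0; rewrite enormZ ger0_norm ?invr_ge0 ?enorm_ge0// mulVf//.
by rewrite enorm_eq0.
Qed.

Lemma direction_neq0 x : x != 0 -> direction x != 0.
Proof. by move=> x0; rewrite -enorm_eq0 enorm_direction// oner_eq0. Qed.

Lemma scale_direction x : x != 0 -> enorm x *: direction x = x.
Proof. by move=> x0; rewrite scalerA divff ?scale1r// enorm_eq0. Qed.

Lemma dot_unit x : enorm x = 1 -> dot x x = 1.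
Proof. by move=> x1; rewrite -sqr_enorm x1 expr1n. Qed.

Lemma enorm_scale_unit a x : enorm x = 1 -> enorm (a *: x) = `|a|.
Proof. by move=> x1; rewrite enormZ x1 mulr1. Qed.

Lemma dot_direction x y : dot (direction x) y = dot x y / enorm x.
Proof. by rewrite dotZl mulrC. Qed.

Lemma exists_unit_orthogonal x :
  exists2 y, enorm y = 1 & dot x y = 0.
Proof.
suff [y y0 xy] : exists2 y, y != 0 & dot x y = 0.
  exists (direction y); first exact: enorm_direction.
  by rewrite dotZr xy mulr0.
have neq10 : (lift ord0 ord0 : 'I_3) != ord0 by [].
have [x0|x0] := eqVneq (x 0 0) 0.
  exists (delta_mx 0 ord0).
    apply/eqP => /rowP/(_ ord0); rewrite !mxE !eqxx; exact/eqP/oner_neq0.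
  rewrite /dot big_ord_recl big1 ?addr0 => [|i _]; first by rewrite x0 mul0r.
  by rewrite !mxE/= mulr0.
exists (x 0 0 *: delta_mx 0 (lift ord0 ord0)
        - x 0 (lift ord0 ord0) *: delta_mx 0 ord0).
  apply/eqP => /rowP/(_ (lift ord0 ord0)); rewrite !mxE !eqxx/= => /eqP.
  by rewrite mulr0 mulr1 subr0 (negbTE x0).
rewrite /dot !big_ord_recl big_ord0 !mxE/=; ring.
Qed.

End Euclidean.

(** * Displacement produced by an open-loop control *)

Section Displacement.
Context {R : realType}.
Notation mu := (@lebesgue_measure R).
Implicit Types (c d : R -> 'rV[R]_3) (e w : 'rV[R]_3) (a b s t : R).

Lemma coord_le_enorm e i : `|e 0 i| <= enorm e.
Proof.
rewrite -ler_sqr ?nnegrE ?enorm_ge0// sqr_enorm real_normK ?num_real//.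
rewrite /dot (bigD1 i)//= expr2 lerDl.
by apply: sumr_ge0 => j _; rewrite -expr2 sqr_ge0.
Qed.

Lemma integrable_control s c a b i : control s c -> 0 <= a ->
  mu.-integrable `[a, b] (EFin \o (fun t => c t 0 i)).
Proof.
move=> [mc nc] a0; apply: measurable_bounded_integrable => //.
- by rewrite /= lebesgue_measure_itv/=; case: ifP; rewrite // -EFinB ltry.
- apply: measurable_funS (mc i) => //.
  by apply: subset_itv; rewrite bnd_simp.
- exists s; split; first exact: num_real.
  move=> M sM t /=; rewrite in_itv/= => /andP[at_ _].
  rewrite (le_trans (coord_le_enorm _ _))// nc ?(le_trans a0)//; exact: ltW.
Qed.

Lemma displacement0 c : displacement c 0 = 0.
Proof. by apply/rowP => i; rewrite !mxE set_itv1 Rintegral_set1. Qed.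

Lemma displacementB s c a b : control s c -> 0 <= a <= b ->
  displacement c b - displacement c a =
  \row_i \int[mu]_(t in `[a, b]) c t 0 i.
Proof.
move=> cc /andP[a0 ab]; apply/rowP => i; rewrite !mxE.
rewrite Rintegral_itvB ?bnd_simp//; last exact: integrable_control cc _.
rewrite Rintegral_itv_obnd_cbnd//.
apply: integrableS (integrable_control b i cc a0) => //.
by apply: subset_itv; rewrite bnd_simp.
Qed.

(** Integrating [e . c(t) <= |e| s] and taking for [e] the displacement itself
   bounds the Euclidean length of a vector-valued integral. *)
Lemma enorm_displacementB s c a b : control s c -> 0 <= a <= b ->
  enorm (displacement c b - displacement c a) <= s * (b - a).
Proof.
move=> cc ab; have /andP[a0 ab'] := ab.
have ic i := integrable_control b i cc a0.
set w := displacement c b - _; have wE : w = _ := displacementB cc ab.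
clearbody w.
have s0 : 0 <= s by have [_ /(_ 0 (lexx 0)) <-] := cc; exact: enorm_ge0.
have [->|w0] := eqVneq w 0.
  by rewrite -(scale0r 0) enormZ normr0 mul0r mulr_ge0 ?subr_ge0.
suff : dot w w <= enorm w * (s * (b - a)).
  by rewrite -sqr_enorm expr2 ler_pM2l// enorm_gt0.
have iZ i : mu.-integrable `[a, b] (EFin \o (fun t => w 0 i * c t 0 i)).
  suff : mu.-integrable `[a, b] (fun t => (w 0 i)%:E * (c t 0 i)%:E)%E by [].
  exact: integrableZl (ic i).
have iD f g : mu.-integrable `[a, b] (EFin \o f) ->
    mu.-integrable `[a, b] (EFin \o g) ->
    mu.-integrable `[a, b] (EFin \o (fun t : R => f t + g t)).
  move=> mf mg.
  suff : mu.-integrable `[a, b] ((EFin \o f) \+ (EFin \o g))%E by [].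
  exact: integrableD.
have -> : dot w w = \int[mu]_(t in `[a, b]) dot w (c t).
  rewrite [X in dot _ X = _]wE /dot !big_ord_recl big_ord0 addr0 !mxE.
  under [RHS]eq_Rintegral do rewrite !big_ord_recl big_ord0 addr0.
  rewrite RintegralD//; last exact: iD (iZ _) (iZ _).
  by rewrite RintegralD// !RintegralZl.
have -> : enorm w * (s * (b - a)) = \int[mu]_(t in `[a, b]) (enorm w * s).
  rewrite Rintegral_cst//= lebesgue_measure_itv/= lte_fin.
  case: ltP => /=; first by rewrite mulrA.
  by move=> ba; rewrite (@le_anti _ _ a b) ?ab' ?ba// subrr !mulr0.
apply: le_Rintegral => //.
- have -> : (fun t => dot w (c t)) = (fun t => w 0 ord0 * c t 0 ord0 +
      (w 0 (lift ord0 ord0) * c t 0 (lift ord0 ord0) +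
       w 0 (lift ord0 (lift ord0 ord0)) * c t 0 (lift ord0 (lift ord0 ord0)))).
    by apply/funext => t; rewrite /dot !big_ord_recl big_ord0 addr0.
  exact: iD (iZ _) (iD _ _ (iZ _) (iZ _)).
- apply: measurable_bounded_integrable => //=.
  + by rewrite lebesgue_measure_itv/=; case: ifP; rewrite // -EFinB ltry.
  + exact: bounded_cst.
move=> t /=; rewrite in_itv/= => /andP[at_ _].
have [_ nc] := cc.
by rewrite (le_trans (dot_le_enorm _ _))// nc// (le_trans a0).
Qed.

Lemma enorm_displacement s c t : control s c -> 0 <= t ->
  enorm (displacement c t) <= s * t.
Proof.
move=> cc t0; have := @enorm_displacementB s c 0 t cc.
by rewrite displacement0 !subr0; apply; rewrite lexx.
Qed.

(** The derivative may differ from the control at the right end of the interval,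
   which is where a control that switches at [b] jumps. *)
Lemma displacement_primitive s c d (F : R -> 'rV[R]_3) a b :
  control s c -> 0 <= a <= b ->
  (forall i t, is_derive t 1 (fun t => F t 0 i) (d t 0 i)) ->
  (forall i, continuous (fun t => d t 0 i)) ->
  (forall t, a <= t < b -> c t = d t) ->
  displacement c b = displacement c a + (F b - F a).
Proof.
move=> cc ab Fd dcont cd; have /andP[a0] := ab.
rewrite le_eqVlt => /predU1P[<-|ltab]; first by rewrite subrr addr0.
apply/eqP; rewrite addrC -subr_eq (displacementB cc ab); apply/eqP/rowP => i.
have cF : continuous (fun t => F t 0 i).
  by move=> t; apply/differentiable_continuous/derivable1_diffP; case: (Fd i t).
rewrite !mxE -Rintegral_itv_bndo_bndc; last first.
  apply: integrableS (integrable_control b i cc a0) => //.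
  by apply: subset_itv; rewrite bnd_simp.
transitivity (\int[mu]_(t in `[a, b[) d t 0 i).
  by apply: eq_Rintegral => t; rewrite inE/= in_itv/= => /cd ->.
rewrite Rintegral_itv_bndo_bndc; last first.
  apply: (@integrableS _ _ _ mu `[a, b]) => //.
    by apply: subset_itv; rewrite bnd_simp.
  apply: continuous_compact_integrable; first exact: segment_compact.
  exact: continuous_subspaceT.
rewrite /Rintegral (@continuous_FTC2 _ _ (fun t => F t 0 i))//.
- exact: continuous_subspaceT.
- split=> [t _||]; first by case: (Fd i t).
  + exact/cvg_at_right_filter/cF.
  + exact/cvg_at_left_filter/cF.
- by move=> t _; rewrite derive1E; case: (Fd i t).
Qed.

Lemma displacement_cst s c w t : control s c -> 0 <= t ->
  (forall r, 0 <= r < t -> c r = w) -> displacement c t = t *: w.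
Proof.
move=> cc t0 cw.
have := @displacement_primitive s c (fun=> w) ( *:%R^~ w) 0 t cc.
rewrite displacement0 scale0r subr0 add0r; apply => //; first by rewrite lexx.
- move=> i r; under eq_fun do rewrite mxE.
  by apply: is_derive_eq; rewrite /GRing.scale/= mulr1 mulr0 add0r.
- by move=> i r; exact: cvg_cst.
Qed.

Lemma control_cst s w : enorm w = s -> control s (fun=> w).
Proof. by move=> ws; split=> // i; exact: measurable_cst. Qed.

End Displacement.

(** * The evader heads straight for the target *)

Section StraightRun.
Context {R : realType} (U V : R) (U_gt0 : 0 < U) (UV : U <= V).
Variables (x : state R).
Hypotheses (x1_neq0 : x.1 != 0) (x12 : x.2 != x.1)
  (closer : V * enorm x.1 <= U * enorm x.2).

Let T := enorm x.1 / U.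
Let T_ge0 : 0 <= T. Proof. by rewrite divr_ge0 ?enorm_ge0// ltW. Qed.

Definition run_to_target : 'rV[R]_3 := - U *: direction x.1.

Lemma enorm_run_to_target : enorm run_to_target = U.
Proof.
by rewrite enorm_scale_unit ?enorm_direction// normrN gtr0_norm.
Qed.

Lemma straight_position t :
  x.1 + t *: run_to_target = (enorm x.1 - t * U) *: direction x.1.
Proof.
by rewrite scalerBl scale_direction// /run_to_target scalerA mulrN scaleNr.
Qed.

(** The pursuer cannot reach a point of the evader's segment in time: the
   triangle inequality excludes this for [U < V]; for [U = V] it only leaves the
   equality case, in which the pursuer starts at the evader's position. *)
Lemma straight_run_not_caught t w : 0 <= t < T -> enorm w <= V * t ->
  x.2 + w != x.1 + t *: run_to_target.
Proof.
move=> /andP[t0 tT] wt; apply/negP => /eqP E; case/negP: x12; apply/eqP.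
rewrite straight_position in E; set e := direction x.1 in E.
have e1 : enorm e = 1 by exact: enorm_direction.
have x1E : enorm x.1 *: e = x.1 by exact: scale_direction.
clearbody e.
set a := enorm x.1 - t * U in E.
have a0 : 0 < a by rewrite subr_gt0 -ltr_pdivlMr.
have x2E : x.2 = a *: e - w by rewrite -E addrK.
have x2le : enorm x.2 <= a + V * t.
  rewrite x2E (le_trans (ler_enormD _ _))// enormN enorm_scale_unit//.
  by rewrite gtr0_norm// lerD2l.
have VU : V = U.
  apply/eqP; rewrite eq_le UV andbT -subr_le0 -(pmulr_lle0 _ a0).
  have : V * enorm x.1 <= U * (a + V * t).
    by rewrite (le_trans closer)// ler_pM2l.
  by rewrite /a -subr_ge0 -(subr_ge0 (_ * _)) => h; apply: le_trans h _;
    rewrite le_eqVlt; apply/orP; left; apply/eqP; ring.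
(* equality case: [w] has to be [- U t e] *)
have ww : dot w w <= (U * t) ^+ 2.
  rewrite -sqr_enorm ler_sqr ?nnegrE ?enorm_ge0 ?mulr_ge0//; last exact: ltW.
  by rewrite -VU.
have x1x2 : enorm x.1 ^+ 2 <= dot x.2 x.2.
  rewrite -sqr_enorm ler_sqr ?nnegrE ?enorm_ge0//.
  by move: closer; rewrite VU ler_pM2l.
have ew : dot e w <= - (U * t).
  rewrite -(ler_pM2l a0); move: x1x2.
  rewrite x2E !dotE (dot_unit e1) (dotC w e).
  have -> : enorm x.1 = a + t * U by rewrite /a subrK.
  by nra.
have : dot (w + (U * t) *: e) (w + (U * t) *: e) <= 0.
  rewrite !dotE (dot_unit e1) (dotC w e).
  have : (U * t) * dot e w <= (U * t) * - (U * t).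
    by rewrite ler_wpM2l// mulr_ge0// ltW.
  by lra.
rewrite le_eqVlt ltNge dot_ge0 orbF dot_eq0 addr_eq0 => /eqP wE.
rewrite x2E wE opprK -scalerDl /a [t * U]mulrC subrK.
exact: x1E.
Qed.

(** Terminal states form a closed set and trajectories are Lipschitz, so at the
   infimum of the times at which the run is stopped early the state would be
   terminal; but up to that time the evader follows the segment. *)
Lemma straight_run_not_stopped u v : control U u -> control V v ->
  generated_by (fun=> run_to_target) (traj x u v) u ->
  forall s, 0 <= s < T -> ~ terminal (traj x u v s).
Proof.
move=> cu cv gu s sT ts; set z := traj x u v in gu ts.
pose B := [set s | 0 <= s < T /\ terminal (z s)].
have Bs : B s by [].
have infB : has_inf B by split; [exists s | exists 0 => r [/andP[]]].
set sg := inf B.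
have sgs : sg <= s by apply: ge_inf => //; exact: (infB.2).
have sg0 : 0 <= sg by apply: lb_le_inf; [exists s | move=> r [/andP[]]].
have sgT : sg < T by case/andP: sT => _; exact: le_lt_trans.
have nterm r : 0 <= r < sg -> ~ terminal (z r).
  move=> /andP[r0 rsg] tr; have : sg <= r.
    by apply: ge_inf; [exact: infB.2 | split; rewrite // r0 (lt_trans rsg)].
  by rewrite leNgt rsg.
have du : displacement u sg = sg *: run_to_target.
  apply: (displacement_cst cu) => // r /andP[r0 rsg]; apply: gu => // q.
  by move=> /andP[q0 qr]; apply: nterm; rewrite q0 (le_lt_trans qr).
have z1 : (z sg).1 != 0.
  rewrite /z/= du straight_position scaler_eq0 negb_or direction_neq0// andbT.
  by rewrite subr_eq0 gt_eqF// -ltr_pdivlMr.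
have z12 : (z sg).2 - (z sg).1 != 0.
  rewrite subr_eq0 /z/= du straight_run_not_caught ?sg0//.
  exact: enorm_displacement.
(* [d / (U + V)] is a time during which the state stays non-terminal after [sg] *)
pose d := Num.min (enorm (z sg).1) (enorm ((z sg).2 - (z sg).1)).
have d0 : 0 < d by rewrite lt_min !enorm_gt0 z1 z12.
have V0 : 0 < V by exact: lt_le_trans UV.
have UV0 : 0 < U + V by exact: addr_gt0.
have [q [/andP[q0 qT] tq] qsg] := inf_adherent (divr_gt0 d0 UV0) infB.
have sgq : 0 <= sg <= q.
  by rewrite sg0/=; apply: ge_inf; [exact: infB.2 | split; rewrite ?q0].
have {}qsg : (U + V) * (q - sg) < d.
  by rewrite mulrC -ltr_pdivlMr// ltrBlDl.
have qsg0 : 0 <= q - sg by rewrite subr_ge0; case/andP: sgq.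
have lu := enorm_displacementB cu sgq; have lv := enorm_displacementB cv sgq.
move: tq => [zq|[zq _]].
- have E : displacement u q - displacement u sg = - (z sg).1.
    have /eqP : x.1 + displacement u q = 0 := zq.
    by rewrite addrC addr_eq0 => /eqP ->; rewrite -opprD.
  have : d <= U * (q - sg) by rewrite (le_trans _ lu)// E enormN ge_min lexx.
  have : 0 <= V * (q - sg) by rewrite mulr_ge0// ltW.
  by lra.
- have E : (z sg).2 - (z sg).1 = (displacement u q - displacement u sg)
      - (displacement v q - displacement v sg).
    have -> : displacement v q = x.1 + displacement u q - x.2.
      by rewrite -[x.1 + _]zq addrC addKr.
    by apply/rowP => i; rewrite !mxE; ring.
  have : d <= U * (q - sg) + V * (q - sg).
    rewrite (le_trans _ (lerD lu lv))// -[X in _ + X]enormN.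
    by rewrite (le_trans _ (ler_enormD _ _))// -E ge_min lexx orbT.
  by lra.
Qed.

Lemma straight_run_reaches u v : control U u -> control V v ->
  generated_by (fun=> run_to_target) (traj x u v) u ->
  reaches_target (traj x u v) T.
Proof.
move=> cu cv gu; have nst := straight_run_not_stopped cu cv gu.
split=> //=; rewrite (displacement_cst (w := run_to_target) cu)//.
  by rewrite straight_position divfK ?gt_eqF// subrr scale0r.
move=> r /andP[r0 rT]; apply: gu => // q /andP[q0 qr]; apply: nst.
by rewrite q0 (le_lt_trans qr).
Qed.

Lemma straight_run_payoff u v : control U u -> control V v ->
  generated_by (fun=> run_to_target) (traj x u v) u ->
  (payoff (traj x u v) <= (- enorm x.2 + enorm x.1 / (U / V))%:E)%E.
Proof.
move=> cu cv gu; apply: (@le_trans _ _ (- enorm (traj x u v T).2)%:E).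
  by apply: ereal_inf_lbound; exists T => //; exact: straight_run_reaches.
rewrite lee_fin /=.
have -> : enorm x.1 / (U / V) = V * T by rewrite invf_div mulrCA.
have := ler_enormB x.2 (- displacement v T).
rewrite opprK enormN; have := enorm_displacement cv T_ge0; lra.
Qed.

End StraightRun.

Lemma constant_evader_strategy (R : realType) (U V : R) (w : 'rV[R]_3) :
  enorm w = U -> evader_strategy U V (fun=> w).
Proof.
by move=> wU; split=> // x0 v _; exists (fun=> w) => //; exact: control_cst.
Qed.

Lemma constant_pursuer_strategy (R : realType) (U V : R) (w : 'rV[R]_3) :
  enorm w = V -> pursuer_strategy U V (fun=> w).
Proof.
by move=> wV; split=> // x0 u _; exists (fun=> w) => //; exact: control_cst.
Qed.

(** * The pursuer approaches the target and circles around it *)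

Section Patrol.
Context {R : realType} (V r : R) (e f : 'rV[R]_3).
Hypotheses (V_gt0 : 0 < V) (r_gt0 : 0 < r)
  (e1 : enorm e = 1) (f1 : enorm f = 1) (ef : dot e f = 0).
Implicit Types (p : 'rV[R]_3) (th t tau : R).

Definition circle th : 'rV[R]_3 := r *: (cos th *: e + sin th *: f).

Definition tangent th : 'rV[R]_3 := V *: (cos th *: f - sin th *: e).

Definition on_circle p := exists th, p = circle th.

Let dot_ee : dot e e = 1. Proof. exact: dot_unit. Qed.
Let dot_ff : dot f f = 1. Proof. exact: dot_unit. Qed.
Let dot_fe : dot f e = 0. Proof. by rewrite dotC. Qed.

(** On the circle this is the tangent field ([patrol_circle]), written without
    the angle so that it visibly depends on the position only. *)
Definition patrol p : 'rV[R]_3 :=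
  if `[< on_circle p >] then (V / r) *: (dot p e *: f - dot p f *: e)
  else - V *: e.

Lemma enorm_circle th : enorm (circle th) = r.
Proof.
rewrite /circle enormZ gtr0_norm// /enorm !dotE ef dot_fe dot_ee dot_ff.
set q := (X in Num.sqrt X); have -> : q = 1.
  by rewrite /q -[RHS](cos2Dsin2 th); ring.
by rewrite sqrtr1 mulr1.
Qed.

Lemma enorm_tangent th : enorm (tangent th) = V.
Proof.
rewrite /tangent enormZ gtr0_norm// /enorm !dotE ef dot_fe dot_ee dot_ff.
set q := (X in Num.sqrt X); have -> : q = 1.
  by rewrite /q -[RHS](cos2Dsin2 th); ring.
by rewrite sqrtr1 mulr1.
Qed.

Lemma patrol_circle th : patrol (circle th) = tangent th.
Proof.
rewrite /patrol asboolT; last by exists th.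
rewrite /circle /tangent !dotE ef dot_fe dot_ee dot_ff.
rewrite !(mulr0, mulr1, addr0, add0r) !scalerBr !scalerA.
by congr (_ *: _ - _ *: _); field; rewrite gt_eqF.
Qed.

Lemma patrol_off p : ~ on_circle p -> patrol p = - V *: e.
Proof. by move=> np; rewrite /patrol asboolF. Qed.

Lemma enorm_patrol p : enorm (patrol p) = V.
Proof.
have [[th ->]|np] := pselect (on_circle p).
  by rewrite patrol_circle enorm_tangent.
by rewrite patrol_off// enorm_scale_unit// normrN gtr0_norm.
Qed.

(** A line parallel to [e] meets the circle at angles [th] and [pi - th] only, so
   a straight run that meets the circle has a first meeting time. *)
Lemma first_meeting p :
  (forall t, 0 <= t -> ~ on_circle (p - (V * t) *: e)) \/
  exists tau th, [/\ 0 <= tau, p - (V * tau) *: e = circle th &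
    forall t, 0 <= t < tau -> ~ on_circle (p - (V * t) *: e)].
Proof.
have [[t0 [t00 [th E]]]|no] :=
    pselect (exists t, 0 <= t /\ on_circle (p - (V * t) *: e)); last first.
  by left=> t t0 ot; apply: no; exists t.
right.
have coords t q : p - (V * t) *: e = circle q ->
    dot p e - V * t = r * cos q /\ dot p f = r * sin q.
  move=> Eq; have := congr1 (fun z => dot z f) Eq; have := congr1 (fun z => dot z e) Eq.
  rewrite /= /circle !dotE ef dot_fe dot_ee dot_ff.
  by rewrite !(mulr0, mulr1, subr0, addr0, add0r).
have pE := coords _ _ E.
(* the intersections are symmetric, at abscissas r cos th and - r cos th *)
pose t1 := t0 + 2 * r * cos th / V.
have E1 : p - (V * t1) *: e = circle (pi - th).
  rewrite /circle cosB sinB cospi sinpi !(mul0r, mulN1r, sub0r, addr0) opprK.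
  have -> : V * t1 = V * t0 + 2 * r * cos th.
    by rewrite /t1; field; rewrite gt_eqF.
  rewrite scalerDl opprD addrA E /circle !scalerDr !scalerA.
  by apply/rowP => i; rewrite !mxE; ring.
have only t : on_circle (p - (V * t) *: e) -> t = t0 \/ t = t1.
  move=> [q /coords [ce se]].
  have : (r * cos q) ^+ 2 = (r * cos th) ^+ 2.
    rewrite !exprMn !cos2sin2 !mulrBr -!exprMn -se; case: pE => _ <-.
    by [].
  move/eqP; rewrite eqf_sqr => /orP[] /eqP cq; [left|right].
    apply: (mulfI (lt0r_neq0 V_gt0)); case: pE => pe _; move: ce pe; rewrite cq.
    by lra.
  apply: (mulfI (lt0r_neq0 V_gt0)).
  have -> : V * t1 = V * t0 + 2 * (r * cos th).
    by rewrite /t1; field; rewrite gt_eqF.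
  by case: pE => pe _; move: ce pe; rewrite cq; lra.
have [/andP[t10 t1lt]|] := boolP (0 <= t1 < t0).
  exists t1, (pi - th); split=> // t /andP[tge0 tlt] /only[] tE.
    by move: tlt; rewrite tE ltNge ltW.
  by move: tlt; rewrite tE ltxx.
rewrite negb_and => t1n; exists t0, th; split=> // t /andP[tge0 tlt] /only[] tE.
  by move: tlt; rewrite tE ltxx.
by move: t1n; rewrite -tE tge0 tlt.
Qed.

Definition phase tau th t := th + V / r * (t - tau).

Definition patrol_control tau th t : 'rV[R]_3 :=
  if t < tau then - V *: e else tangent (phase tau th t).

Lemma is_derive_circle tau th i t :
  is_derive t 1 (fun t => circle (phase tau th t) 0 i)
    (tangent (phase tau th t) 0 i).
Proof.
have dphase : is_derive t 1 (phase tau th) (V / r).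
  rewrite /phase; apply: is_derive_eq.
  by rewrite /GRing.scale/= add0r mul1r subr0 mulr1.
have dcos := is_derive1_comp (is_derive_cos (phase tau th t)) dphase.
have dsin := is_derive1_comp (is_derive_sin (phase tau th t)) dphase.
have -> : (fun t => circle (phase tau th t) 0 i) =
    r *: ((e 0 i) *: (cos \o phase tau th) + (f 0 i) *: (sin \o phase tau th)).
  apply/funext => s; rewrite /circle !mxE/=.
  by rewrite (mulrC (cos _)) (mulrC (sin _)).
have dsum := is_deriveD (is_deriveZ (e 0 i) dcos) (is_deriveZ (f 0 i) dsin).
apply: (is_derive_eq (is_deriveZ r dsum)).
rewrite /tangent !mxE -![_ *: (_ : R)]/(_ * _).
by field; rewrite gt_eqF.
Qed.

Lemma continuous_tangent tau th i :
  continuous (fun t => tangent (phase tau th t) 0 i).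
Proof.
have cphase : continuous (phase tau th).
  move=> t; rewrite /phase; apply: cvgD; first exact: cvg_cst.
  by apply: cvgM; [exact: cvg_cst | apply: cvgB => //; exact: cvg_cst].
move=> t; under eq_fun do rewrite /tangent !mxE.
apply: cvgM; first exact: cvg_cst.
apply: cvgB; (apply: cvgM; last exact: cvg_cst).
  by apply: continuous_comp; [exact: cphase | exact: continuous_cos].
by apply: continuous_comp; [exact: cphase | exact: continuous_sin].
Qed.

Lemma control_patrol tau th : control V (patrol_control tau th).
Proof.
split=> [i|t _].
  apply: (@measurable_funS _ _ _ _ setT) => //.
  rewrite (_ : (fun t => _) = fun t => if t < tau then (- V *: e) 0 i
      else tangent (phase tau th t) 0 i); last first.
    by apply/funext => t; rewrite /patrol_control; case: ifP.
  apply: measurable_fun_ifT; [|exact: measurable_cst|].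
    by apply: measurable_fun_ltr => //; exact: measurable_cst.
  by apply: continuous_measurable_fun; exact: continuous_tangent.
rewrite /patrol_control; case: ifP => _; last exact: enorm_tangent.
by rewrite enorm_scale_unit// normrN gtr0_norm.
Qed.

Lemma displacement_patrol_before tau th t : 0 <= t <= tau ->
  displacement (patrol_control tau th) t = - (V * t) *: e.
Proof.
move=> /andP[t0 ttau].
rewrite (displacement_cst (w := - V *: e) (control_patrol tau th))//.
  by rewrite scalerA mulrN mulrC.
by move=> s /andP[_ st]; rewrite /patrol_control (lt_le_trans st).
Qed.

Lemma displacement_patrol_after tau th p t : 0 <= tau <= t ->
  p - (V * tau) *: e = circle th ->
  p + displacement (patrol_control tau th) t = circle (phase tau th t).
Proof.
move=> taut pE; have /andP[tau0 ltt] := taut.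
have -> : displacement (patrol_control tau th) t =
    displacement (patrol_control tau th) tau
    + (circle (phase tau th t) - circle (phase tau th tau)).
  apply: (displacement_primitive (F := circle \o phase tau th)
    (d := tangent \o phase tau th) (control_patrol tau th) taut).
  - by move=> i s; exact: is_derive_circle.
  - by move=> i; exact: continuous_tangent.
  - by move=> s /andP[taus _]; rewrite /patrol_control ltNge taus.
rewrite displacement_patrol_before ?tau0 ?lexx// addrA scaleNr pE.
have -> : phase tau th tau = th by rewrite /phase subrr mulr0 addr0.
by rewrite addrC subrK.
Qed.

Lemma patrol_control_law tau th p : 0 <= tau ->
  p - (V * tau) *: e = circle th ->
  (forall t, 0 <= t < tau -> ~ on_circle (p - (V * t) *: e)) ->
  forall t, 0 <= t ->
    patrol_control tau th t = patrol (p + displacement (patrol_control tau th) t).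
Proof.
move=> tau0 pE before t t0; have [ttau|taut] := ltP t tau.
  rewrite displacement_patrol_before ?t0 ?ltW// scaleNr patrol_off.
    by rewrite /patrol_control ttau.
  by apply: before; rewrite t0.
rewrite (displacement_patrol_after _ pE) ?tau0// patrol_circle.
by rewrite /patrol_control ltNge taut.
Qed.

(** Existence from every position is what makes [patrol] a strategy. *)
Lemma patrol_solution p : exists2 v, control V v &
  forall t, 0 <= t -> v t = patrol (p + displacement v t).
Proof.
have [never|[tau [th [tau0 pE before]]]] := first_meeting p.
  have cv : control V (fun=> - V *: e).
    by apply: control_cst; rewrite enorm_scale_unit// normrN gtr0_norm.
  exists (fun=> - V *: e) => // t t0.
  rewrite (displacement_cst (w := - V *: e) cv)//.
  by rewrite scalerA mulrN mulrC patrol_off// scaleNr; exact: never.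
exists (patrol_control tau th); first exact: control_patrol.
exact: patrol_control_law.
Qed.

(** The actual initial position of the pursuer has this form, by choice of [e];
    its straight run first meets the circle at [r e]. *)
Lemma patrol_solution_radial rho : r < rho -> exists v, [/\ control V v,
  forall t, 0 <= t -> v t = patrol (rho *: e + displacement v t) &
  forall t, (rho - r) / V <= t -> enorm (rho *: e + displacement v t) = r].
Proof.
move=> rrho; pose tau := (rho - r) / V.
have tau0 : 0 <= tau by rewrite divr_ge0 ?ltW// subr_gt0.
have Vtau : V * tau = rho - r by rewrite mulrC divfK// gt_eqF.
have pE : rho *: e - (V * tau) *: e = circle 0.
  by rewrite Vtau /circle cos0 sin0 scale0r addr0 scale1r -scalerBl subKr.
exists (patrol_control tau 0); split; first exact: control_patrol.
  apply: patrol_control_law => // t /andP[t0 ttau] [th E].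
  have : enorm (rho *: e - (V * t) *: e) = r by rewrite E enorm_circle.
  have : V * t < rho - r by rewrite -Vtau ltr_pM2l.
  rewrite -scalerBl enorm_scale_unit// => lt.
  rewrite gtr0_norm => [h|]; last by move: r_gt0; lra.
  by move: lt; rewrite -h; lra.
move=> t taut; rewrite (displacement_patrol_after _ pE) ?tau0//.
exact: enorm_circle.
Qed.

Lemma patrol_strategy U : pursuer_strategy U V (fun x => patrol x.2).
Proof.
split=> [x|x u _]; first exact: enorm_patrol.
have [v cv vE] := patrol_solution x.2.
by exists v => // t t0 _; exact: vE.
Qed.

End Patrol.

(** * The Value *)

Section Value.
Context {R : realType} (U V : R) (U_gt0 : 0 < U) (V_gt0 : 0 < V) (UV : U <= V).
Variables (x : state R).
Hypotheses (x1_neq0 : x.1 != 0) (x12 : x.2 != x.1)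
  (closer : V * enorm x.1 <= U * enorm x.2).

Notation W := (- enorm x.2 + enorm x.1 / (U / V)).

Let WE : W = - enorm x.2 + V * (enorm x.1 / U).
Proof. by rewrite invf_div mulrCA. Qed.

Let W_le0 : W <= 0.
Proof.
by rewrite WE mulrA addrC subr_le0 ler_pdivrMr// [_ * U]mulrC.
Qed.

Let W_gt : - enorm x.2 < W.
Proof. by rewrite WE ltrDl mulr_gt0// divr_gt0// enorm_gt0. Qed.

Let x2_neq0 : x.2 != 0.
Proof.
rewrite -enorm_gt0 -(pmulr_rgt0 _ U_gt0); apply: lt_le_trans closer.
by rewrite mulr_gt0// enorm_gt0.
Qed.

Lemma reach_time u v T : control U u -> reaches_target (traj x u v) T ->
  enorm x.1 / U <= T.
Proof.
move=> cu [T0 /= /eqP]; rewrite addr_eq0 => /eqP xT _.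
by rewrite ler_pdivrMr// [_ * U]mulrC xT enormN enorm_displacement.
Qed.

Lemma straight_guaranteed :
  (guaranteed_payoff U V (fun=> run_to_target U x) x <= W%:E)%E.
Proof.
apply: ge_ereal_sup => _ [h [_ [_ [u [v [cu cv -> gu _]]] ->]]].
exact: straight_run_payoff.
Qed.

(** Circling at a radius [r] that is reached before the evader can arrive makes
   every arrival cost at least [- r]. *)
Lemma patrol_guaranteed g r : evader_strategy U V g -> - W < r < enorm x.2 ->
  ((- r)%:E <= guaranteed_payoff U V g x)%E.
Proof.
move=> [_ sg] /andP[Wr rx]; set e := direction x.2.
have e1 : enorm e = 1 by exact: enorm_direction.
have [f f1 ef] := exists_unit_orthogonal e.
have r0 : 0 < r by apply: le_lt_trans Wr; rewrite oppr_ge0.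
have [v [cv vE far]] := patrol_solution_radial V_gt0 r0 e1 f1 ef rx.
rewrite scale_direction// in vE far.
have [u cu gu] := sg x v cv.
apply: (@le_trans _ _ (payoff (traj x u v))); last first.
  apply: ereal_sup_ubound; exists (fun y => patrol V r e f y.2), (traj x u v).
  split=> //; first exact: patrol_strategy.
  by exists u, v; split=> // t t0 _; exact: vE.
apply: le_ereal_inf_tmp => _ [T rT <-]; rewrite lee_fin lerN2 /= far//.
rewrite (le_trans _ (reach_time cu rT))// ler_pdivrMr// mulrC.
by move: Wr; rewrite WE; lra.
Qed.

Lemma guaranteed_payoff_ge g : evader_strategy U V g ->
  (W%:E <= guaranteed_payoff U V g x)%E.
Proof.
move=> sg; apply/lee_addgt0Pr => eps eps0.
pose r := Num.min (- W + eps) ((- W + enorm x.2) / 2).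
have rlt : - W < r < enorm x.2.
  rewrite lt_min gt_min ltrDl eps0/= !(ltr_pdivlMr, ltr_pdivrMr)//.
  by have := W_gt => Wgt; apply/andP; split; [lra | apply/orP; right; lra].
apply: (@le_trans _ _ ((- r)%:E + eps%:E)%E); last first.
  by rewrite leeD2r//; exact: patrol_guaranteed.
rewrite -EFinD lee_fin -lerBlDr lerNr opprB addrC.
by rewrite ge_min lexx.
Qed.

Let g := fun _ : state R => run_to_target U x.

Let sg : evader_strategy U V g.
Proof. exact/constant_evader_strategy/enorm_run_to_target. Qed.

Lemma game_valueE : game_value U V x = W%:E.
Proof.
apply/eqP; rewrite eq_le; apply/andP; split.
  apply: le_trans straight_guaranteed.
  by apply: ereal_inf_lbound; exists g.
by apply: le_ereal_inf_tmp => _ [k sk <-]; exact: guaranteed_payoff_ge.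
Qed.

Lemma game_value_attained : value_attained U V x.
Proof.
exists g => //; rewrite game_valueE; split.
  by apply/eqP; rewrite eq_le straight_guaranteed guaranteed_payoff_ge.
pose w := - V *: direction x.2; pose u := fun _ : R => run_to_target U x.
have wV : enorm w = V.
  by rewrite enorm_scale_unit ?enorm_direction// normrN gtr0_norm.
have cu : control U u by exact/control_cst/enorm_run_to_target.
have cv : control V (fun=> w) by exact: control_cst.
exists (fun=> w), (traj x u (fun=> w)); split.
- exact: constant_pursuer_strategy.
- by exists u, (fun=> w).
apply/eqP; rewrite eq_le straight_run_payoff//=.
apply: le_ereal_inf_tmp => _ [T rT <-].
have T0 : 0 <= T by case: rT.
have -> : T = enorm x.1 / U.
  case: rT => _ /eqP; rewrite /= (displacement_cst (w := run_to_target U x) cu)//.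
  rewrite straight_position// scaler_eq0 (negbTE (direction_neq0 _))// orbF.
  by rewrite subr_eq0 => /eqP -> _; rewrite mulfK// gt_eqF.
rewrite lee_fin /= (displacement_cst (w := w) cv)//; last first.
  by rewrite divr_ge0 ?enorm_ge0// ltW.
have -> : x.2 + (enorm x.1 / U) *: w =
    (enorm x.2 - V * (enorm x.1 / U)) *: direction x.2.
  by rewrite scalerBl scale_direction// /w scalerA mulrN scaleNr [_ * V]mulrC.
rewrite enorm_scale_unit ?enorm_direction// ger0_norm; last first.
  by move: W_le0; rewrite WE; lra.
by rewrite WE; lra.
Qed.

End Value.

(** * Differentiability of the Value and the Isaacs equation *)

Section Regularity.
Context {R : realType}.
Implicit Types (a h : 'rV[R]_3) (x v : state R).

Lemma is_diff_coord a i :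
  is_diff a (fun y : 'rV[R]_3 => y 0 i) (fun h : 'rV[R]_3 => h 0 i).
Proof.
have @f : {linear 'rV[R]_3 -> R}.
  by exists (fun N : 'rV[R]_3 => N 0 i); do 2![eexists]; do ?[constructor];
     rewrite ?mxE// => ? *; rewrite ?mxE//; move=> ?; rewrite !mxE.
apply: DiffDef; first exact: differentiable_coord.
by rewrite (_ : (fun _ => _) = f)// diff_lin//; exact: coord_continuous.
Qed.

Lemma is_diff_sqrt (s : R) : 0 < s ->
  is_diff s (@Num.sqrt R) (fun k => k * (2 * Num.sqrt s)^-1).
Proof.
move=> s0; have [ds dE] := is_derive1_sqrt s0.
apply: DiffDef; first exact/derivable1_diffP.
by rewrite deriv1E// derive1E dE.
Qed.

Lemma is_diff_dotxx a :
  is_diff a (fun y => dot y y) (fun h => 2 * dot a h).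
Proof.
have d2 i := is_diffM (is_diff_coord a i) (is_diff_coord a i).
have ddot := is_diffD (d2 ord0)
  (is_diffD (d2 (lift ord0 ord0)) (d2 (lift ord0 (lift ord0 ord0)))).
set sq := (X in is_diff a X _) in ddot.
have sqE : sq = fun y => dot y y.
  by apply/funext => y; rewrite /dot !big_ord_recl big_ord0 addr0.
rewrite -sqE; apply: (is_diff_eq ddot); apply/funext => h.
rewrite /dot !big_ord_recl big_ord0 addr0 /=.
rewrite -![(_ + _) h]/(_ h + _ h) /= -![(_ *: _) h]/(_ * _).
by ring.
Qed.

Lemma is_diff_enorm a : a != 0 ->
  is_diff a (@enorm R) (fun h => dot a h / enorm a).
Proof.
move=> a0; have dot0 : 0 < dot a a by rewrite lt_def dot_eq0 a0 dot_ge0.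
apply: (is_diff_eq (is_diff_comp (is_diff_dotxx a) (is_diff_sqrt dot0))).
by apply/funext => h /=; rewrite -/(enorm a); field; rewrite enorm_eq0.
Qed.

Lemma is_diff_fst x : is_diff x (@fst 'rV[R]_3 'rV[R]_3) fst.
Proof.
have c : continuous (fst : {linear ('rV[R]_3 * 'rV[R]_3)%type -> 'rV[R]_3}).
  by move=> y; exact: cvg_fst.
by apply: DiffDef; [exact: linear_differentiable | exact: diff_lin].
Qed.

Lemma is_diff_snd x : is_diff x (@snd 'rV[R]_3 'rV[R]_3) snd.
Proof.
have c : continuous (snd : {linear ('rV[R]_3 * 'rV[R]_3)%type -> 'rV[R]_3}).
  by move=> y; exact: cvg_snd.
by apply: DiffDef; [exact: linear_differentiable | exact: diff_lin].
Qed.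

Variable alpha : R.

Definition value_formula x : R := - enorm x.2 + enorm x.1 / alpha.

Definition value_gradient x : state R :=
  (alpha^-1 *: direction x.1, - direction x.2).

(** An open set that contains the non-terminal states of the winning region and
    on which the formula is smooth; that region itself is not open. *)
Definition off_target : set (state R) := [set x | x.1 != 0 /\ x.2 != 0].

Lemma is_diff_value_formula x : off_target x ->
  is_diff x value_formula (fun v => dot (value_gradient x).1 v.1
                                    + dot (value_gradient x).2 v.2).
Proof.
move=> [x1 x2].
have d1 := is_diff_comp (is_diff_fst x) (is_diff_enorm x1).
have d2 := is_diff_comp (is_diff_snd x) (is_diff_enorm x2).
have := is_diffD (is_diffN d2) (is_diffZ alpha^-1 d1).
set F := (X in is_diff x X _ -> _); have -> : F = value_formula.
  by apply/funext => y; rewrite /value_formula [_ / alpha]mulrC.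
move=> dF; apply: (is_diff_eq dF); apply/funext => v /=.
rewrite dotZl dotNl !dot_direction addrC.
by [].
Qed.

Lemma gradient_value_formula x : off_target x ->
  gradient value_formula x = value_gradient x.
Proof.
move=> ox; have [df dE] := is_diff_value_formula ox.
have dot_delta a i : dot a (delta_mx 0 i) = a 0 i.
  rewrite /dot (bigD1 i)//= mxE !eqxx mulr1 big1 ?addr0// => j ji.
  by rewrite mxE (negbTE ji) andbF mulr0.
have dot0 a : dot a 0 = 0 by rewrite -(scale0r 0) dotZr mul0r.
rewrite [RHS]surjective_pairing; congr pair; apply/rowP => i.
  by rewrite mxE deriveE// dE /= dot0 addr0 dot_delta.
by rewrite mxE deriveE// dE /= dot0 add0r dot_delta.
Qed.

Lemma continuous_enorm : continuous (@enorm R).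
Proof.
move=> a; apply: (@continuous_comp _ _ _ (fun y => dot y y) Num.sqrt);
  last exact: sqrt_continuous.
by apply: differentiable_continuous; case: (is_diff_dotxx a).
Qed.

Let cfst : continuous (fst : state R -> 'rV[R]_3).
Proof. by move=> y; exact: cvg_fst. Qed.

Let csnd : continuous (snd : state R -> 'rV[R]_3).
Proof. by move=> y; exact: cvg_snd. Qed.

Lemma open_off_target : open off_target.
Proof.
have op (f : state R -> 'rV[R]_3) : continuous f -> open [set x | f x != 0].
  move=> cf; rewrite (_ : [set x | _] = (@enorm R \o f) @^-1` [set y | y != 0]).
    apply: open_comp; last exact: open_neq.
    by move=> x _; apply: continuous_comp; [exact: cf | exact: continuous_enorm].
  by apply/seteqP; split=> x /=; rewrite enorm_eq0.
by apply: openI; apply: op.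
Qed.

Lemma continuous_value_gradient x : off_target x ->
  {for x, continuous value_gradient}.
Proof.
move=> [x1 x2].
have cdir (f : state R -> 'rV[R]_3) : f x != 0 -> {for x, continuous f} ->
    {for x, continuous (direction \o f)}.
  move=> fx cf; apply: cvgZ; last exact: cf.
  apply: cvgV; first by rewrite enorm_eq0.
  by apply: continuous_comp; [exact: cf | exact: continuous_enorm].
have c1 : alpha^-1 *: direction y.1 @[y --> x] --> alpha^-1 *: direction x.1.
  apply: (@continuous_comp _ _ _ (direction \o fst) ( *:%R alpha^-1)).
    exact: (cdir fst x1 (@cfst x)).
  exact: scaler_continuous.
have c2 : - direction y.2 @[y --> x] --> - direction x.2.
  apply: (@continuous_comp _ _ _ (direction \o snd) -%R).
    exact: (cdir snd x2 (@csnd x)).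
  exact: opp_continuous.
exact: (cvg_pair c1 c2).
Qed.

Lemma C1_value_formula x : off_target x ->
  differentiable value_formula x /\
  {for x, continuous (gradient value_formula)}.
Proof.
move=> ox; split; first by case: (is_diff_value_formula ox).
rewrite /prop_for /continuous_at (gradient_value_formula ox).
apply: cvg_trans (continuous_value_gradient ox).
apply: near_eq_cvg; apply: filterS (open_nbhs_nbhs (conj open_off_target ox)).
by move=> y oy; rewrite gradient_value_formula.
Qed.

(** Against the gradient, the best pursuer velocity is [- V x_P/|x_P|] and the
   best evader velocity is [- U x_E/|x_E|], by Cauchy-Schwarz; they contribute
   [V] and [- U / alpha = - V]. *)
Lemma isaacs_value_gradient (U V : R) x : 0 < U -> 0 < V -> alpha = U / V ->
  off_target x -> isaacs_equation U V (value_gradient x).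
Proof.
move=> U0 V0 alphaE [x1 x2].
have n1 := enorm_direction x1; have n2 := enorm_direction x2.
set e := direction x.1 in n1; set q := direction x.2 in n2.
have -> : value_gradient x = (alpha^-1 *: e, - q) by [].
clearbody e q.
have UVa : alpha^-1 * U = V by rewrite alphaE; field; rewrite !gt_eqF.
have ia0 : 0 <= alpha^-1 by rewrite alphaE invf_div divr_ge0// ltW.
have vq : enorm (- V *: q) = V.
  by rewrite enorm_scale_unit// normrN gtr0_norm.
split=> [|m [u uU [_ ubm]]] /=.
  exists (- U *: e); first by rewrite enorm_scale_unit// normrN gtr0_norm.
  have Ee : dot (alpha^-1 *: e) (- U *: e) = - V.
    by rewrite !dotE dot_unit// mulr1 mulrN UVa.
  split => /=.
    exists (- V *: q) => //.
    by rewrite Ee dotNl dotZr dot_unit//; ring.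
  move=> _ [v vV <-]; rewrite Ee.
  have := dot_le_enorm (- q) v; rewrite enormN n2 vV; lra.
have le_m : dot (alpha^-1 *: e) u + dot (- q) (- V *: q) <= m.
  by apply: ubm; exists (- V *: q).
apply: le_trans le_m; rewrite dotZl dotNl dotZr dot_unit//.
have := dot_le_enorm (- e) u; rewrite enormN n1 uU dotNl => eu.
have : alpha^-1 * - dot e u <= alpha^-1 * (1 * U) by exact: ler_wpM2l.
by rewrite mul1r UVa; lra.
Qed.

End Regularity.

Theorem theorem2 (R : realType) (U V : R) (U_gt0 : 0 < U) (V_gt0 : 0 < V)
    (alpha_le1 : U / V <= 1) :
  let alpha := U / V in
  let S := [set x : state R | evader_region alpha x /\ ~ terminal x] in
  (forall x : state R, S x ->
     value_attained U V x /\
     game_value U V x = (- enorm x.2 + enorm x.1 / alpha)%:E) /\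
  (exists2 G : state R -> state R,
     C1_with_gradient S (fun x => fine (game_value U V x)) G &
     forall x : state R, S x -> isaacs_equation U V (G x)).
Proof.
move=> alpha S.
have UV : U <= V by rewrite ler_pdivrMr// mul1r in alpha_le1.
have alpha0 : 0 < alpha by exact: divr_gt0.
have Sx x : S x ->
    [/\ x.1 != 0, x.2 != x.1 & V * enorm x.1 <= U * enorm x.2].
  move=> [xr nt]; have x1 : x.1 != 0 by apply/eqP => x1; apply: nt; left.
  split=> //; first by apply/eqP => x12; apply: nt; right.
  move: xr; rewrite /evader_region /= subr_le0 -exprMn.
  have ax2 := mulr_ge0 (ltW alpha0) (enorm_ge0 x.2).
  rewrite ler_sqr ?nnegrE ?enorm_ge0// => xr.
  rewrite mulrC -ler_pdivlMr// (le_trans xr)// /alpha.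
  by rewrite le_eqVlt; apply/orP; left; apply/eqP; ring.
have Soff : S `<=` off_target.
  move=> x /Sx[x1 _ closer]; split=> //.
  rewrite -enorm_gt0 -(pmulr_rgt0 _ U_gt0) (lt_le_trans _ closer)//.
  by rewrite mulr_gt0// enorm_gt0.
split=> [x /Sx[x1 x12 closer]|].
  by split; [exact: game_value_attained | exact: game_valueE].
exists (value_gradient alpha).
  exists off_target, (value_formula alpha); split=> //.
  - exact: open_off_target.
  - by move=> x ox; exact: C1_value_formula.
  - move=> x xS; split; last by apply: gradient_value_formula; exact: Soff.
    by have [x1 x12 closer] := Sx _ xS; rewrite game_valueE.
by move=> x xS; apply: isaacs_value_gradient => //; exact: Soff.
Qed.
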